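(* Let $\mathcal C$ be a convex arc with total curvature $\int_{\mathcal C}\kappa\,ds\le\pi$ whose radius of curvature satisfies $R_1\le\rho\le R_2$ at every point, for constants $0<R_1\le R_2$. Let $\mathcal L$ be a lattice in $\mathbb R^2$ and let $\delta>0$ satisfy $$\delta<\frac{d_{\mathcal L}^2}{2\left(R_2+d_{\mathcal L}+\sqrt{(R_2+d_{\mathcal L})^2-d_{\mathcal L}^2}\right)}.$$ Let $L=\mathrm{Length}(\mathcal C)$. If $$\frac{L^3}{8R_1}+2L\delta+3\delta^2\le A_{\mathcal L},$$ then $$\#\{Q\in\mathcal L:\mathrm{dist}(Q,\mathcal C)<\delta\}\le 2.$$
   Context: A lattice is a set $\mathcal L=\mathcal L(v_0,v_1,v_2)=\{v_0+mv_1+nv_2: m,n\in\mathbb Z\}$ where $v_0,v_1,v_2\in\mathbb R^2$ and $v_1,v_2$ are linearly independent; $A_{\mathcal L}=|\det(v_1,v_2)|$ and $d_{\mathcal L}=\min\{\|P-Q\|:P,Q\in\mathcal L,\ P\ne Q\}$. Curves are of class $C^2$ with nonvanishing first and second derivative vectors, oriented so that the curvature $\kappa$ is positive; a convex arc is such a non-closed curve on the boundary of a convex planar region. $\rho=1/\kappa$, $s$ is arclength, and $\mathrm{dist}(Q,\mathcal C)$ is the Euclidean distance from $Q$ to $\mathcal C$. *)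

(* Defs.v *)
From Stdlib Require Import Reals Lra.
From Coquelicot Require Import Coquelicot.
Open Scope R_scope.

Definition pt := (R * R)%type.

Definition edist (P Q : pt) : R :=
  sqrt ((fst P - fst Q) ^ 2 + (snd P - snd Q) ^ 2).

Definition det2 (v1 v2 : pt) : R := fst v1 * snd v2 - snd v1 * fst v2.

Definition lin_indep (v1 v2 : pt) : Prop := det2 v1 v2 <> 0.

Definition in_lattice (v0 v1 v2 : pt) (P : pt) : Prop :=
  exists m n : Z,
    P = (fst v0 + IZR m * fst v1 + IZR n * fst v2,
         snd v0 + IZR m * snd v1 + IZR n * snd v2).

Definition lattice_area (v1 v2 : pt) : R := Rabs (det2 v1 v2).

Definition is_lattice_min_dist (v0 v1 v2 : pt) (d : R) : Prop :=
  (exists P Q, in_lattice v0 v1 v2 P /\ in_lattice v0 v1 v2 Q /\ P <> Q /\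
               edist P Q = d) /\
  (forall P Q, in_lattice v0 v1 v2 P -> in_lattice v0 v1 v2 Q -> P <> Q ->
               d <= edist P Q).

Definition C2_regular_curve (a b : R) (x y x1 y1 x2 y2 : R -> R) : Prop :=
  a < b /\
  forall t, a <= t <= b ->
    is_derive x t (x1 t) /\ is_derive y t (y1 t) /\
    is_derive x1 t (x2 t) /\ is_derive y1 t (y2 t) /\
    continuous x2 t /\ continuous y2 t /\
    x1 t ^ 2 + y1 t ^ 2 <> 0 /\ x2 t ^ 2 + y2 t ^ 2 <> 0.

Definition speed (x1 y1 : R -> R) (t : R) : R := sqrt (x1 t ^ 2 + y1 t ^ 2).

Definition curvature (x1 y1 x2 y2 : R -> R) (t : R) : R :=
  (x1 t * y2 t - y1 t * x2 t) / (speed x1 y1 t ^ 3).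

Definition convex_set (K : pt -> Prop) : Prop :=
  forall P Q (l : R), K P -> K Q -> 0 <= l <= 1 ->
    K ((1 - l) * fst P + l * fst Q, (1 - l) * snd P + l * snd Q).

Definition in_interior (K : pt -> Prop) (P : pt) : Prop :=
  exists e, 0 < e /\ forall Q, edist P Q < e -> K Q.

Definition in_closure (K : pt -> Prop) (P : pt) : Prop :=
  forall e, 0 < e -> exists Q, K Q /\ edist P Q < e.

Definition in_boundary (K : pt -> Prop) (P : pt) : Prop :=
  in_closure K P /\ ~ in_interior K P.

Definition convex_arc (a b : R) (x y x1 y1 x2 y2 : R -> R) : Prop :=
  C2_regular_curve a b x y x1 y1 x2 y2 /\
  (forall t, a <= t <= b -> 0 < curvature x1 y1 x2 y2 t) /\
  (x a, y a) <> (x b, y b) /\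
  exists K : pt -> Prop,
    convex_set K /\ (exists P, in_interior K P) /\
    forall t, a <= t <= b -> in_boundary K (x t, y t).

(* dist(Q, C) < delta, i.e. inf_{t ∈ [a,b]} ||Q - gamma(t)|| < delta *)
Definition dist_to_curve_lt (a b : R) (x y : R -> R) (Q : pt) (delta : R) : Prop :=
  exists t, a <= t <= b /\ edist Q (x t, y t) < delta.

(* Main.v *)
(** Suppose three lattice points [Q1, Q2, Q3] lie within [delta] of curve points
    [P1, P2, P3]. The cross product of [Q2 - Q1] and [Q3 - Q2] is an integer
    multiple of the lattice area.

    If it is nonzero, it exceeds the same cross product for the [Pi] by less
    than [2 L delta + 3 delta^2]. The latter is a double integral of
    [sin (th tau - th sigma) <= (tau - sigma) / R1] over two consecutive
    arcs of lengths [s] and [u], hence at most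
    [s u (s + u) / (2 R1) <= L^3 / (8 R1)].

    If it is zero, one of the points, [M], lies between the other two. Since
    the radius of curvature is at most [R2] and the total turning at most [PI],
    the whole arc lies in the disc of radius [R2] tangent to it at the
    curve point near [M]. If [O] is its center, then [|OM| > R2 - delta], while
    Stewart's theorem gives [|OM|^2 + d^2 < (R2 + delta)^2]. Hence
    [d^2 < 4 R2 delta], against the smallness of [delta]. *)

Require Import Defs.
From Corelib Require Import ssreflect.
From Stdlib Require Import Reals List Lra Lia.
From Coquelicot Require Import Coquelicot.
Open Scope R_scope.
Set Bullet Behavior "Strict Subproofs".

(** * Comparison of increments and polar coordinates *)

(** The integral estimates on the curve are obtained in this form, by comparison with an explicit
    primitive [g]. *)
Lemma derive_le_increment (f g df dg : R -> R) (p q : R) :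
  p <= q ->
  (forall t, p <= t <= q -> is_derive f t (df t)) ->
  (forall t, p <= t <= q -> is_derive g t (dg t)) ->
  (forall t, p <= t <= q -> df t <= dg t) ->
  f q - f p <= g q - g p.
Proof.
  intros Hpq Hf Hg Hle.
  assert (Hd : forall t, p <= t <= q ->
            is_derive (fun s => g s - f s) t (dg t - df t)).
  { intros t Ht. apply: is_derive_minus; auto. }
  destruct (MVT_gen (fun s => g s - f s) p q (fun t => dg t - df t))
    as [c [Hc E]].
  - intros t Ht. rewrite Rmin_left // Rmax_right // in Ht. apply Hd. lra.
  - intros t Ht. rewrite Rmin_left // Rmax_right // in Ht.
    apply derivable_continuous_pt.
    exists (dg t - df t). apply is_derive_Reals. now apply Hd.
  - rewrite Rmin_left // Rmax_right // in Hc.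
    pose proof (Hle c Hc). nra.
Qed.

Lemma derive_abs_le_increment (f g df dg : R -> R) (p q : R) :
  p <= q ->
  (forall t, p <= t <= q -> is_derive f t (df t)) ->
  (forall t, p <= t <= q -> is_derive g t (dg t)) ->
  (forall t, p <= t <= q -> Rabs (df t) <= dg t) ->
  Rabs (f q - f p) <= g q - g p.
Proof.
  intros Hpq Hf Hg Hle. apply Rabs_le. split.
  - assert (- f q - - f p <= g q - g p); [|lra].
    apply (derive_le_increment (fun t => - f t) g (fun t => - df t) dg); auto.
    + intros t Ht. apply: is_derive_opp; auto.
    + intros t Ht. pose proof (Hle t Ht) as H. apply Rabs_le_between in H. lra.
  - apply (derive_le_increment f g df dg); auto.
    intros t Ht. pose proof (Hle t Ht) as H. apply Rabs_le_between in H. lra.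
Qed.

(** The free [base] lets the window of admissible angles be centred where a later sign analysis
    needs it, for instance at a tangent angle. *)
Lemma polar_form (X Y base : R) :
  exists phi, base - PI <= phi <= base + PI /\
    X = sqrt (X ^ 2 + Y ^ 2) * cos phi /\ Y = sqrt (X ^ 2 + Y ^ 2) * sin phi.
Proof.
  set (r := sqrt (X ^ 2 + Y ^ 2)).
  assert (Hr0 : 0 <= r) by apply sqrt_pos.
  assert (Hr2 : r ^ 2 = X ^ 2 + Y ^ 2) by (apply pow2_sqrt; nra).
  pose proof (sin2_cos2 base) as Hb. unfold Rsqr in Hb.
  destruct (Req_dec r 0) as [Z|NZ].
  { exists base. pose proof PI_RGT_0. rewrite Z in Hr2 |- *.
    split; [lra|]. split; nra. }
  (* [(c, s)] is the unit vector along [(X, Y)] rotated by [- base]. Its angle is [acos c] or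
     [- acos c] according to the sign of [s], hence within [PI] of zero. *)
  set (c := (X * cos base + Y * sin base) / r).
  set (s := (Y * cos base - X * sin base) / r).
  assert (Ec : r * c = X * cos base + Y * sin base) by (unfold c; field; auto).
  assert (Es : r * s = Y * cos base - X * sin base) by (unfold s; field; auto).
  assert (Hcs : c * c + s * s = 1).
  { apply Rmult_eq_reg_l with (r ^ 2); [|nra].
    replace (r ^ 2 * (c * c + s * s)) with ((r * c) ^ 2 + (r * s) ^ 2) by ring.
    rewrite Ec Es Hr2.
    replace (_ + _) with
      ((X ^ 2 + Y ^ 2) * (sin base * sin base + cos base * cos base)) by ring.
    rewrite Hb. ring. }
  assert (Hc : -1 <= c <= 1) by nra.
  assert (EX : X = r * c * cos base - r * s * sin base).
  { rewrite Ec Es.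
    transitivity (X * (sin base * sin base + cos base * cos base)); [|ring].
    rewrite Hb; ring. }
  assert (EY : Y = r * c * sin base + r * s * cos base).
  { rewrite Ec Es.
    transitivity (Y * (sin base * sin base + cos base * cos base)); [|ring].
    rewrite Hb; ring. }
  pose proof (acos_bound c) as Hac.
  pose proof (cos_acos c Hc) as Hca. pose proof (sin_acos c Hc) as Hsa.
  replace (1 - Rsqr c) with (Rsqr s) in Hsa by (unfold Rsqr; lra).
  rewrite sqrt_Rsqr_abs in Hsa.
  destruct (Rle_dec 0 s) as [Hs|Hs].
  - rewrite Rabs_pos_eq // in Hsa.
    exists (base + acos c). split; [lra|].
    rewrite cos_plus sin_plus Hca Hsa.
    split; [rewrite {1}EX | rewrite {1}EY]; ring.
  - rewrite Rabs_left in Hsa; [|lra].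
    exists (base - acos c). split; [lra|].
    rewrite cos_minus sin_minus Hca Hsa.
    split; [rewrite {1}EX | rewrite {1}EY]; ring.
Qed.

Lemma Rabs_sin_le (u : R) : Rabs (sin u) <= Rabs u.
Proof.
  assert (H : forall w, 0 <= w -> Rabs (sin w) <= w).
  { intros w Hw. pose proof PI_RGT_0. pose proof PI2_1.
    destruct (Rle_dec w PI) as [Hp|Hp].
    - rewrite Rabs_pos_eq; [|apply sin_ge_0; lra].
      destruct (Req_dec w 0) as [->|Hn]; [rewrite sin_0; lra|].
      apply Rlt_le, sin_lt_x; lra.
    - pose proof (SIN_bound w). apply Rabs_le. lra. }
  destruct (Rle_dec 0 u) as [Hu|Hu].
  - rewrite (Rabs_pos_eq u) //. auto.
  - rewrite -(Rabs_Ropp (sin u)) -sin_neg (Rabs_left u); [|lra].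
    apply H; lra.
Qed.

(** * Curves described by speed and tangent angle *)

(* [v] is the speed, [th] the tangent angle and [k = th'] the curvature times
   the speed. [th] is differentiable on all of [R], not only on [[p, q]]. *)
Definition angle_param (p q : R) (x y v th k : R -> R) : Prop :=
  (forall t, is_derive th t (k t)) /\
  forall t, p <= t <= q ->
    is_derive x t (v t * cos (th t)) /\ is_derive y t (v t * sin (th t)) /\
    0 <= v t.

Lemma angle_param_sub (p q p' q' : R) (x y v th k : R -> R) :
  angle_param p q x y v th k -> p <= p' -> q' <= q ->
  angle_param p' q' x y v th k.
Proof. intros [Hth H] H1 H2. split; auto. intros t Ht. apply H. lra. Qed.

(* The reflection in the second axis followed by a reversal of the parameter
   keeps the curvature positive. *)
Lemma angle_param_reverse (p q : R) (x y v th k : R -> R) :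
  angle_param p q x y v th k ->
  angle_param (- q) (- p) (fun t => - x (- t)) (fun t => y (- t))
    (fun t => v (- t)) (fun t => - th (- t)) (fun t => k (- t)).
Proof.
  intros [Hth H].
  assert (Hneg : forall (f : R -> R) t l, is_derive f (- t) l ->
            is_derive (fun s => f (- s)) t (- l)).
  { intros f t l Hf.
    evar_last.
    - apply (is_derive_comp f (fun s => - s)); [exact Hf|].
      apply: is_derive_opp. apply is_derive_id.
    - rewrite /scal /= /mult /= /opp /= /one /=. ring. }
  split.
  - intros t. evar_last.
    + apply: is_derive_opp. apply Hneg, Hth.
    + rewrite /opp /=. ring.
  - intros t Ht. destruct (H (- t)) as [Hx [Hy Hv]]; [lra|].
    rewrite cos_neg sin_neg. split; [|split]; auto.
    + evar_last.
      * apply: is_derive_opp. apply Hneg, Hx.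
      * rewrite /opp /=. ring.
    + evar_last; [apply Hneg, Hy|]. ring.
Qed.

(** * Support values and the tangent disc *)

(** The function is the coordinate, measured from [(ox, oy)], along [(sin mu, - cos mu)]: the
    outward normal of a counterclockwise convex curve where its tangent angle is [mu]. *)
Lemma is_derive_normal_form (x y v th : R -> R) (t ox oy mu : R) :
  is_derive x t (v t * cos (th t)) -> is_derive y t (v t * sin (th t)) ->
  is_derive (fun s => (x s - ox) * sin mu - (y s - oy) * cos mu) t
    (v t * sin (mu - th t)).
Proof.
  intros Hx Hy. rewrite sin_minus.
  auto_derive.
  - split; [|split]; [eexists; exact Hx|eexists; exact Hy|exact I].
  - rewrite (is_derive_unique (fun s : R => x s) _ _ Hx)
      (is_derive_unique (fun s : R => y s) _ _ Hy). ring.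
Qed.

(** [r * cos (mu - th)] is the coordinate along that normal, measured from the center, of the point
    of a circle of radius [r] with tangent angle [th]. *)
Lemma is_derive_cos_sub (th k : R -> R) (r mu t : R) :
  is_derive th t (k t) ->
  is_derive (fun s => r * cos (mu - th s)) t (r * k t * sin (mu - th t)).
Proof.
  intros H. auto_derive.
  - eexists; exact H.
  - rewrite (is_derive_unique (fun s : R => th s) _ _ H). unfold Rminus; ring.
Qed.

Lemma angle_nondecreasing (p q r : R) (x y v th k : R -> R) :
  angle_param p q x y v th k -> 0 < r ->
  (forall t, p <= t <= q -> v t <= r * k t) ->
  forall s t, p <= s -> s <= t -> t <= q -> th s <= th t.
Proof.
  intros [Hth H] Hr Hvk s t Hs Hst Ht.
  assert (0 - 0 <= th t - th s); [|lra].
  apply (derive_le_increment (fun _ => 0) th (fun _ => 0) k); auto.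
  - intros w _. apply: is_derive_const.
  - intros w Hw. destruct (H w) as [_ [_ Hv]]; [lra|].
    pose proof (Hvk w). nra.
Qed.

Lemma angle_value (th k : R -> R) (p q m : R) :
  (forall t, is_derive th t (k t)) -> p <= q -> th p <= m <= th q ->
  exists t, p <= t <= q /\ th t = m.
Proof.
  intros Hth Hpq Hm.
  destruct (IVT_gen th p q m) as [t [Ht E]].
  - intros t. apply derivable_continuous_pt. exists (k t).
    apply is_derive_Reals, Hth.
  - rewrite Rmin_left; [|lra]. rewrite Rmax_right; lra.
  - rewrite Rmin_left // Rmax_right // in Ht. eauto.
Qed.

(* While [sin (mu - th) >= 0] the support value grows at most as fast as
   that of the circle of radius [r] with the same tangent angle; while
   [sin (mu - th) <= 0] it decreases. Total turning at most [PI] leaves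
   at most one sign change. *)
Lemma support_value_le (p q r : R) (x y v th k : R -> R) (mu : R) :
  angle_param p q x y v th k -> 0 < r -> p <= q ->
  (forall t, p <= t <= q -> v t <= r * k t) ->
  th q - th p <= PI ->
  th p - PI <= mu <= th p + PI ->
  (x q - (x p - r * sin (th p))) * sin mu
  - (y q - (y p + r * cos (th p))) * cos mu <= r.
Proof.
  intros Hap Hr Hpq Hvk Htot Hmu.
  pose proof (angle_nondecreasing _ _ _ _ _ _ _ _ Hap Hr Hvk) as Hmon.
  destruct Hap as [Hth H].
  set (h := fun s => (x s - (x p - r * sin (th p))) * sin mu
                     - (y s - (y p + r * cos (th p))) * cos mu).
  change (h q <= r).
  assert (Hp : h p = r * cos (mu - th p)).
  { unfold h. rewrite cos_minus. ring. }
  assert (Hh : forall t, p <= t <= q -> is_derive h t (v t * sin (mu - th t))).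
  { intros t Ht. destruct (H t Ht) as [? [? _]].
    now apply is_derive_normal_form. }
  assert (Hdown : forall s t, p <= s -> s <= t -> t <= q ->
            (forall w, s <= w <= t -> sin (mu - th w) <= 0) -> h t <= h s).
  { intros s t Hs Hst Ht Hsin.
    assert (h t - h s <= 0 - 0); [|lra].
    apply (derive_le_increment h (fun _ => 0)
             (fun t => v t * sin (mu - th t)) (fun _ => 0)); auto.
    - intros w Hw. apply Hh. lra.
    - intros w _. apply: is_derive_const.
    - intros w Hw. destruct (H w) as [_ [_ Hv]]; [lra|].
      pose proof (Hsin w Hw). nra. }
  assert (Hup : forall s t, p <= s -> s <= t -> t <= q ->
            (forall w, s <= w <= t -> 0 <= sin (mu - th w)) ->
            h t - h s <= r * cos (mu - th t) - r * cos (mu - th s)).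
  { intros s t Hs Hst Ht Hsin.
    apply (derive_le_increment h (fun t => r * cos (mu - th t))
             (fun t => v t * sin (mu - th t))
             (fun t => r * k t * sin (mu - th t))); auto.
    - intros w Hw. apply Hh. lra.
    - intros w _. apply is_derive_cos_sub, Hth.
    - intros w Hw. apply Rmult_le_compat_r; auto. apply Hvk. lra. }
  pose proof (Hmon p q (Rle_refl _) Hpq (Rle_refl _)) as Hpq'.
  assert (Hneg : forall u, - PI <= u <= 0 -> sin u <= 0).
  { intros u Hu. rewrite -(Ropp_involutive u) sin_neg.
    pose proof (sin_ge_0 (- u)). lra. }
  assert (Hpos2 : forall u, - (2 * PI) <= u <= - PI -> 0 <= sin u).
  { intros u Hu. rewrite -(Ropp_involutive u) sin_neg.
    pose proof (sin_le_0 (- u)). lra. }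
  (* Along the arc [sin (mu - th)] can change sign only where [th] passes [mu] (from plus to minus)
     or [mu + PI] (from minus to plus). The four cases are: nonnegative throughout, plus then minus,
     nonpositive throughout, minus then plus. *)
  destruct (Rle_dec (th p) mu) as [Hm|Hm].
  - destruct (Rle_dec (th q) mu) as [Hq|Hq].
    + assert (h q - h p <= r * cos (mu - th q) - r * cos (mu - th p)).
      { apply Hup; try lra. intros w Hw.
        pose proof (Hmon p w). pose proof (Hmon w q). apply sin_ge_0; lra. }
      pose proof (COS_bound (mu - th q)). nra.
    + destruct (angle_value th k p q mu) as [m [Hpm Em]]; auto; [lra|].
      assert (h m - h p <= r * cos (mu - th m) - r * cos (mu - th p)).
      { apply Hup; try lra. intros w Hw.
        pose proof (Hmon p w). pose proof (Hmon w m). apply sin_ge_0; lra. }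
      assert (h q <= h m).
      { apply Hdown; try lra. intros w Hw.
        pose proof (Hmon m w). pose proof (Hmon w q). apply Hneg; lra. }
      pose proof (COS_bound (mu - th m)). nra.
  - destruct (Rle_dec (th q) (mu + PI)) as [Hq|Hq].
    + assert (h q <= h p).
      { apply Hdown; try lra. intros w Hw.
        pose proof (Hmon p w). pose proof (Hmon w q). apply Hneg; lra. }
      pose proof (COS_bound (mu - th p)). nra.
    + destruct (angle_value th k p q (mu + PI)) as [m [Hpm Em]]; auto; [lra|].
      assert (h m <= h p).
      { apply Hdown; try lra. intros w Hw.
        pose proof (Hmon p w). pose proof (Hmon w m). apply Hneg; lra. }
      assert (h q - h m <= r * cos (mu - th q) - r * cos (mu - th m)).
      { apply Hup; try lra. intros w Hw.
        pose proof (Hmon m w). pose proof (Hmon w q). apply Hpos2; lra. }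
      assert (Em' : cos (mu - th m) = -1).
      { rewrite Em. replace (mu - (mu + PI)) with (- PI) by ring.
        now rewrite cos_neg cos_PI. }
      (* The estimates so far give [h q <= r * (cos (mu - th p) + cos (mu - th q) + 1)]. In the
         sum-to-product formula the half difference is at most [PI / 2], and the half sum, up to
         sign, lies between [PI / 2] and [3 * PI / 2]. *)
      assert (Hsum : cos (mu - th p) + cos (mu - th q) <= 0).
      { rewrite form1.
        replace ((mu - th p - (mu - th q)) / 2) with ((th q - th p) / 2) by lra.
        assert (0 <= cos ((th q - th p) / 2)) by (apply cos_ge_0; lra).
        assert (cos ((mu - th p + (mu - th q)) / 2) <= 0); [|nra].
        rewrite -cos_neg. apply cos_le_0; lra. }
      rewrite Em' in H1. nra.
Qed.

(** The distance to the center is the support value in the direction of the point itself. That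
    direction is [(sin mu, - cos mu)], so [mu] is a polar angle of [(- Y, X)], taken within [PI] of
    [th p]. *)
Lemma in_tangent_disc_forward (p q r : R) (x y v th k : R -> R) :
  angle_param p q x y v th k -> 0 < r -> p <= q ->
  (forall t, p <= t <= q -> v t <= r * k t) ->
  th q - th p <= PI ->
  edist (x q, y q) (x p - r * sin (th p), y p + r * cos (th p)) <= r.
Proof.
  intros Hap Hr Hpq Hvk Htot. unfold edist; simpl fst; simpl snd.
  set (X := x q - (x p - r * sin (th p))).
  set (Y := y q - (y p + r * cos (th p))).
  destruct (polar_form (- Y) X (th p)) as [mu [Hmu [EY EX]]].
  replace ((- Y) ^ 2 + X ^ 2) with (X ^ 2 + Y ^ 2) in EX, EY by ring.
  pose proof (support_value_le p q r x y v th k mu Hap Hr Hpq Hvk Htot Hmu)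
    as Hs.
  fold X Y in Hs.
  set (d := sqrt (X ^ 2 + Y ^ 2)) in *.
  pose proof (sin2_cos2 mu) as E. unfold Rsqr in E.
  assert (d = X * sin mu - Y * cos mu); [|lra].
  replace (X * sin mu) with (d * sin mu * sin mu) by (rewrite -EX; ring).
  replace (Y * cos mu) with (- (d * cos mu * cos mu)) by (rewrite -EY; ring).
  transitivity (d * (sin mu * sin mu + cos mu * cos mu)); [rewrite E|]; ring.
Qed.

(** Points after [m] are covered by the forward case. For points before [m], the reflected and
    reversed curve starts at the image of [m], and its tangent disc there is the mirror image of the
    original one. *)
Lemma in_tangent_disc (p q r : R) (x y v th k : R -> R) (m t : R) :
  angle_param p q x y v th k -> 0 < r ->
  (forall t, p <= t <= q -> v t <= r * k t) ->
  th q - th p <= PI ->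
  p <= m <= q -> p <= t <= q ->
  edist (x t, y t) (x m - r * sin (th m), y m + r * cos (th m)) <= r.
Proof.
  intros Hap Hr Hvk Htot Hm Ht.
  pose proof (angle_nondecreasing _ _ _ _ _ _ _ _ Hap Hr Hvk) as Hmon.
  pose proof (Hmon p m). pose proof (Hmon m q).
  pose proof (Hmon p t). pose proof (Hmon t q).
  destruct (Rle_dec m t) as [Hmt|Hmt].
  - apply (in_tangent_disc_forward m t r x y v th k); auto; try lra.
    + apply (angle_param_sub p q); auto; lra.
    + intros w Hw. apply Hvk. lra.
  - assert (Hap' : angle_param t m x y v th k)
      by (apply (angle_param_sub p q); auto; lra).
    pose proof (in_tangent_disc_forward (- m) (- t) r _ _ _ _ _
      (angle_param_reverse _ _ _ _ _ _ _ Hap') Hr) as HD.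
    cbv beta in HD. rewrite !Ropp_involutive sin_neg cos_neg in HD.
    unfold edist in HD |- *; simpl fst in HD |- *; simpl snd in HD |- *.
    replace ((x t - (x m - r * sin (th m))) ^ 2) with
      ((- x t - (- x m - r * - sin (th m))) ^ 2) by ring.
    apply HD; try lra. intros w Hw. apply Hvk. lra.
Qed.

(** * The tangent angle and arclength of a regular curve *)

(** Extending [f] continuously from the segment to the whole line makes its primitive differentiable
    everywhere, in particular on both sides of [a] and [b]. *)
Lemma primitive_on_segment (f : R -> R) (a b c : R) :
  a <= b -> (forall t, a <= t <= b -> continuous f t) ->
  exists F g : R -> R, (forall t, is_derive F t (g t)) /\
    (forall t, a <= t <= b -> g t = f t) /\
    F a = c /\ F b = c + RInt f a b.
Proof.
  intros Hab Hf.
  destruct (C0_extension_le f a b) as [g [Hg Egf]]; [exact Hf|].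
  exists (fun t => c + RInt g a t), g. split; [|split; [|split]]; auto.
  - intros t. evar_last.
    + apply: is_derive_plus; [apply: is_derive_const|].
      apply (is_derive_RInt g _ a); [|apply Hg].
      apply filter_forall. intros w. apply: RInt_correct. apply: ex_RInt_continuous.
      intros z _. apply Hg.
    + rewrite /plus /zero /=. ring.
  - rewrite RInt_point /zero /=. ring.
  - f_equal. apply RInt_ext. intros t Ht.
    rewrite Rmin_left // Rmax_right // in Ht. apply Egf. lra.
Qed.

Lemma constant_of_derive_zero (f : R -> R) (p q : R) :
  p <= q -> (forall t, p <= t <= q -> is_derive f t 0) -> f q = f p.
Proof.
  intros Hpq Hf.
  assert (Rabs (f q - f p) <= 0 - 0).
  { apply (derive_abs_le_increment f (fun _ => 0) (fun _ => 0) (fun _ => 0));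
      auto.
    - intros t _. apply: is_derive_const.
    - intros t _. rewrite Rabs_R0. lra. }
  pose proof (Rabs_pos (f q - f p)).
  assert (f q - f p = 0) by (apply Rabs_eq_0; lra). lra.
Qed.

(** This is the Frenet equation: the unit tangent turns at the rate curvature times speed. *)
Lemma is_derive_unit_tangent (x1 y1 x2 y2 : R -> R) (t : R) :
  is_derive x1 t (x2 t) -> is_derive y1 t (y2 t) ->
  x1 t ^ 2 + y1 t ^ 2 <> 0 ->
  is_derive (fun s => x1 s / speed x1 y1 s) t
    (- (curvature x1 y1 x2 y2 t * speed x1 y1 t) * (y1 t / speed x1 y1 t)) /\
  is_derive (fun s => y1 s / speed x1 y1 s) t
    (curvature x1 y1 x2 y2 t * speed x1 y1 t * (x1 t / speed x1 y1 t)).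
Proof.
  intros Hx Hy Hn.
  assert (Hpos : 0 < x1 t ^ 2 + y1 t ^ 2) by nra.
  assert (Hs : 0 < speed x1 y1 t) by (apply sqrt_lt_R0; exact Hpos).
  assert (Hs2 : speed x1 y1 t ^ 2 = x1 t ^ 2 + y1 t ^ 2)
    by (apply pow2_sqrt; lra).
  assert (Hd : is_derive (speed x1 y1) t
            ((x1 t * x2 t + y1 t * y2 t) / speed x1 y1 t)).
  { unfold speed. auto_derive.
    - split; [eexists; exact Hx|]. split; [eexists; exact Hy|].
      split; [|exact I]. lra.
    - rewrite (is_derive_unique (fun s : R => x1 s) _ _ Hx)
        (is_derive_unique (fun s : R => y1 s) _ _ Hy).
      fold (speed x1 y1 t). simpl.
      replace (x1 t * (x1 t * 1) + y1 t * (y1 t * 1)) with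
        (x1 t ^ 2 + y1 t ^ 2) by ring.
      fold (speed x1 y1 t). field. lra. }
  unfold curvature. set (w := speed x1 y1 t) in *.
  split.
  - evar_last; [apply is_derive_div; [exact Hx|exact Hd|]; fold w; lra|].
    fold w. apply Rmult_eq_reg_r with (w ^ 3); [|apply pow_nonzero; lra].
    transitivity (x2 t * w ^ 2 - x1 t * (x1 t * x2 t + y1 t * y2 t));
      [field; lra|].
    rewrite Hs2. field. lra.
  - evar_last; [apply is_derive_div; [exact Hy|exact Hd|]; fold w; lra|].
    fold w. apply Rmult_eq_reg_r with (w ^ 3); [|apply pow_nonzero; lra].
    transitivity (y2 t * w ^ 2 - y1 t * (x1 t * x2 t + y1 t * y2 t));
      [field; lra|].
    rewrite Hs2. field. lra.
Qed.

(* A vector turning at the rate [k] and the vector [(cos th, sin th)] with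
   [th' = k] keep constant scalar and cross product. *)
Lemma rotating_frame_angle (f g th k : R -> R) (a b : R) :
  (forall t, is_derive th t (k t)) ->
  (forall t, a <= t <= b -> is_derive f t (- k t * g t)) ->
  (forall t, a <= t <= b -> is_derive g t (k t * f t)) ->
  f a = cos (th a) -> g a = sin (th a) ->
  forall t, a <= t <= b -> f t = cos (th t) /\ g t = sin (th t).
Proof.
  intros Hth Hf Hg Ef Eg t Ht.
  assert (E1 : f t * cos (th t) + g t * sin (th t)
             = f a * cos (th a) + g a * sin (th a)).
  { apply (constant_of_derive_zero
             (fun s => f s * cos (th s) + g s * sin (th s))); [lra|].
    intros s Hs.
    assert (Hfs : is_derive f s (- k s * g s)) by (apply Hf; lra).
    assert (Hgs : is_derive g s (k s * f s)) by (apply Hg; lra).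
    pose proof (Hth s) as Hts.
    auto_derive.
    - repeat match goal with |- _ /\ _ => split end; try exact I;
        eexists; eauto.
    - rewrite (is_derive_unique (fun s : R => f s) _ _ Hfs)
        (is_derive_unique (fun s : R => g s) _ _ Hgs)
        (is_derive_unique (fun s : R => th s) _ _ Hts). ring. }
  assert (E2 : g t * cos (th t) - f t * sin (th t)
             = g a * cos (th a) - f a * sin (th a)).
  { apply (constant_of_derive_zero
             (fun s => g s * cos (th s) - f s * sin (th s))); [lra|].
    intros s Hs.
    assert (Hfs : is_derive f s (- k s * g s)) by (apply Hf; lra).
    assert (Hgs : is_derive g s (k s * f s)) by (apply Hg; lra).
    pose proof (Hth s) as Hts.
    auto_derive.
    - repeat match goal with |- _ /\ _ => split end; try exact I;
        eexists; eauto.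
    - rewrite (is_derive_unique (fun s : R => f s) _ _ Hfs)
        (is_derive_unique (fun s : R => g s) _ _ Hgs)
        (is_derive_unique (fun s : R => th s) _ _ Hts). ring. }
  (* The two constants are 1 and 0 at [a]. Inverting the rotation by [th t] then recovers [f t] and
     [g t]. *)
  pose proof (sin2_cos2 (th a)) as Ua. pose proof (sin2_cos2 (th t)) as Ut.
  unfold Rsqr in Ua, Ut. rewrite Ef Eg in E1, E2.
  set (c := cos (th t)) in *. set (s := sin (th t)) in *.
  assert (E1' : f t * c + g t * s = 1) by lra.
  assert (E2' : g t * c - f t * s = 0) by lra.
  split.
  - transitivity (f t * (s * s + c * c)); [rewrite Ut; ring|].
    transitivity ((f t * c + g t * s) * c - (g t * c - f t * s) * s); [ring|].
    rewrite E1' E2'. ring.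
  - transitivity (g t * (s * s + c * c)); [rewrite Ut; ring|].
    transitivity ((f t * c + g t * s) * s + (g t * c - f t * s) * c); [ring|].
    rewrite E1' E2'. ring.
Qed.

Lemma continuous_of_is_derive (f : R -> R) (t l : R) :
  is_derive f t l -> continuous f t.
Proof. intros H. apply: ex_derive_continuous. eexists; exact H. Qed.

Lemma continuous_speed (x1 y1 : R -> R) (t : R) :
  continuous x1 t -> continuous y1 t -> continuous (speed x1 y1) t.
Proof.
  intros Hx Hy. unfold speed.
  apply (continuous_comp (fun s => x1 s ^ 2 + y1 s ^ 2) sqrt).
  - apply: continuous_plus; simpl; apply: continuous_mult; auto;
      apply: continuous_mult; auto; apply continuous_const.
  - apply continuous_sqrt.
Qed.

Lemma continuous_curvature (x1 y1 x2 y2 : R -> R) (t : R) :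
  continuous x1 t -> continuous y1 t -> continuous x2 t -> continuous y2 t ->
  speed x1 y1 t <> 0 -> continuous (curvature x1 y1 x2 y2) t.
Proof.
  intros Hx Hy Hx2 Hy2 Hn. unfold curvature, Rdiv.
  pose proof (continuous_speed x1 y1 t Hx Hy) as Hs.
  apply: continuous_mult.
  - apply: continuous_minus; apply: continuous_mult; auto.
  - apply (continuous_comp (fun s => speed x1 y1 s ^ 3) Rinv).
    + simpl. apply: continuous_mult; auto. apply: continuous_mult; auto.
      apply: continuous_mult; auto. apply continuous_const.
    + apply continuous_Rinv. now apply pow_nonzero.
Qed.

(** [th] is the integral of curvature times speed, started at a polar angle of the initial velocity.
    The unit tangent and [(cos th, sin th)] turn at the same rate and agree at [a], so they agree on
    the segment. *)
Lemma regular_curve_angle_param (a b : R) (x y x1 y1 x2 y2 : R -> R) :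
  C2_regular_curve a b x y x1 y1 x2 y2 ->
  exists v S th k : R -> R,
    angle_param a b x y v th k /\
    (forall t, is_derive S t (v t)) /\
    (forall t, a <= t <= b -> 0 < v t /\ k t = curvature x1 y1 x2 y2 t * v t) /\
    S b - S a = RInt (fun t => speed x1 y1 t) a b /\
    th b - th a = RInt (fun t => curvature x1 y1 x2 y2 t * speed x1 y1 t) a b.
Proof.
  intros [Hab H].
  assert (Hpos : forall t, a <= t <= b -> 0 < speed x1 y1 t).
  { intros t Ht. apply sqrt_lt_R0. pose proof (H t Ht). nra. }
  assert (Hcs : forall t, a <= t <= b -> continuous (speed x1 y1) t).
  { intros t Ht. destruct (H t Ht) as (_ & _ & Hx & Hy & _).
    apply continuous_speed; eapply continuous_of_is_derive; eassumption. }
  assert (Hck : forall t, a <= t <= b ->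
    continuous (fun t => curvature x1 y1 x2 y2 t * speed x1 y1 t) t).
  { intros t Ht. apply: continuous_mult; auto.
    destruct (H t Ht) as (_ & _ & Hx & Hy & Hx2 & Hy2 & _).
    pose proof (Hpos t Ht).
    apply continuous_curvature; auto; try lra;
      eapply continuous_of_is_derive; eassumption. }
  destruct (primitive_on_segment (fun t => speed x1 y1 t) a b 0)
    as [S [v [HS [Ev [ESa ESb]]]]]; auto; [lra|].
  destruct (polar_form (x1 a) (y1 a) 0) as [phi [_ [Ex Ey]]].
  fold (speed x1 y1 a) in Ex, Ey.
  destruct (primitive_on_segment
    (fun t => curvature x1 y1 x2 y2 t * speed x1 y1 t) a b phi)
    as [th [k [Hth [Ek [Eta Etb]]]]]; auto; [lra|].
  assert (Hang : forall t, a <= t <= b ->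
    x1 t / speed x1 y1 t = cos (th t) /\ y1 t / speed x1 y1 t = sin (th t)).
  { pose proof (Hpos a ltac:(lra)) as Hpa.
    apply (rotating_frame_angle (fun t => x1 t / speed x1 y1 t)
             (fun t => y1 t / speed x1 y1 t) th k a b); auto.
    - intros t Ht. rewrite (Ek t Ht).
      destruct (H t Ht) as (_ & _ & Hx & Hy & _ & _ & Hn & _).
      now apply is_derive_unit_tangent.
    - intros t Ht. rewrite (Ek t Ht).
      destruct (H t Ht) as (_ & _ & Hx & Hy & _ & _ & Hn & _).
      now apply is_derive_unit_tangent.
    - rewrite Eta. rewrite {1}Ex. field. lra.
    - rewrite Eta. rewrite {1}Ey. field. lra. }
  exists v, S, th, k. split; [|split; [|split; [|split]]]; auto.
  - split; auto. intros t Ht. rewrite (Ev t Ht).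
    destruct (Hang t Ht) as [Ec Es]. pose proof (Hpos t Ht).
    destruct (H t Ht) as (Hx & Hy & _).
    rewrite -Ec -Es. split; [|split]; [| |lra].
    + replace (_ * _) with (x1 t) by (field; lra). exact Hx.
    + replace (_ * _) with (y1 t) by (field; lra). exact Hy.
  - intros t Ht. rewrite (Ev t Ht) (Ek t Ht). auto.
  - rewrite ESa ESb. ring.
  - rewrite Eta Etb. ring.
Qed.

(** * Chords and triangles bounded by arclength *)

Section ArcLengthBounds.

Variables (p q : R) (x y v th k S : R -> R).
Hypothesis Hap : angle_param p q x y v th k.
Hypothesis HS : forall t, is_derive S t (v t).

Lemma arclength_nondecreasing (s t : R) :
  p <= s -> s <= t -> t <= q -> S s <= S t.
Proof.
  intros Hs Hst Ht. assert (0 - 0 <= S t - S s); [|lra].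
  apply (derive_le_increment (fun _ => 0) S (fun _ => 0) v); auto.
  - intros w _. apply: is_derive_const.
  - intros w Hw. destruct Hap as [_ H]. apply H. lra.
Qed.

(** The coordinate along the direction of the chord increases by exactly the chord length, at a rate
    at most the speed. *)
Lemma chord_le_arclength (s t : R) :
  p <= s -> s <= t -> t <= q -> edist (x t, y t) (x s, y s) <= S t - S s.
Proof.
  intros Hs Hst Ht. unfold edist; simpl fst; simpl snd.
  destruct (polar_form (- (y t - y s)) (x t - x s) 0) as [mu [_ [EY EX]]].
  replace ((- (y t - y s)) ^ 2 + (x t - x s) ^ 2) with
    ((x t - x s) ^ 2 + (y t - y s) ^ 2) in EX, EY by ring.
  set (d := sqrt ((x t - x s) ^ 2 + (y t - y s) ^ 2)) in *.
  pose proof (sin2_cos2 mu) as E. unfold Rsqr in E.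
  assert (Ed : d = ((x t - 0) * sin mu - (y t - 0) * cos mu)
                   - ((x s - 0) * sin mu - (y s - 0) * cos mu)).
  { transitivity ((x t - x s) * sin mu + (- (y t - y s)) * cos mu); [|ring].
    rewrite EX EY.
    transitivity (d * (sin mu * sin mu + cos mu * cos mu)); [rewrite E|]; ring. }
  rewrite Ed.
  destruct Hap as [_ H].
  apply (derive_le_increment
    (fun s => (x s - 0) * sin mu - (y s - 0) * cos mu) S
    (fun w => v w * sin (mu - th w)) v); auto.
  - intros w Hw. destruct (H w) as [? [? _]]; [lra|].
    now apply is_derive_normal_form.
  - intros w Hw. destruct (H w) as [_ [_ Hv]]; [lra|].
    pose proof (SIN_bound (mu - th w)). nra.
Qed.

Variable r : R.
Hypothesis Hr : 0 < r.
Hypothesis Hk : forall t, p <= t <= q -> 0 <= r * k t <= v t.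

(** [Hk] says that the curvature is nonnegative and at most [1 / r], so the turning is at most
    arclength over [r]. *)
Lemma Rabs_sin_turning_le (s t : R) :
  p <= s -> s <= t -> t <= q -> Rabs (sin (th t - th s)) <= (S t - S s) / r.
Proof.
  intros Hs Hst Ht. eapply Rle_trans; [apply Rabs_sin_le|].
  apply (derive_abs_le_increment th (fun t => S t / r) k (fun t => v t / r)) in Hst.
  - replace ((S t - S s) / r) with (S t / r - S s / r) by (field; lra). exact Hst.
  - intros w _. apply Hap.
  - intros w _. apply: is_derive_scal_l. apply HS.
  - intros w Hw. destruct (Hk w) as [H1 H2]; [lra|].
    apply (Rmult_le_reg_r r); auto.
    rewrite Rabs_pos_eq; [|nra]. field_simplify; lra.
Qed.

(* Integrating [sin (th c - th t)] over [t] gives the area spanned by a chord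
   and a tangent vector. *)
Lemma chord_cross_tangent_le (t1 t2 c : R) :
  p <= t1 -> t1 <= t2 -> t2 <= c -> c <= q ->
  Rabs ((x t2 - x t1) * sin (th c) - (y t2 - y t1) * cos (th c))
  <= (S t2 - S t1) * ((S c - S t1) + (S c - S t2)) / (2 * r).
Proof.
  intros H1 H12 H2c Hc.
  pose proof (derive_abs_le_increment
    (fun t => (x t - x t1) * sin (th c) - (y t - y t1) * cos (th c))
    (* A primitive of [v t * ((S c - S t) / r)], the bound given by [Rabs_sin_turning_le]. *)
    (fun t => (S c * S t - S t ^ 2 / 2) / r)
    (fun t => v t * sin (th c - th t))
    (fun t => v t * ((S c - S t) / r)) t1 t2) as H.
  replace ((x t2 - x t1) * sin (th c) - (y t2 - y t1) * cos (th c)) with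
    ((x t2 - x t1) * sin (th c) - (y t2 - y t1) * cos (th c)
     - ((x t1 - x t1) * sin (th c) - (y t1 - y t1) * cos (th c))) by ring.
  eapply Rle_trans.
  - apply H; auto.
    + intros t Ht. destruct Hap as [_ Ha].
      destruct (Ha t) as [? [? _]]; [lra|]. now apply is_derive_normal_form.
    + intros t Ht. pose proof (HS t) as Hd. auto_derive.
      * repeat match goal with |- _ /\ _ => split end; try exact I; eexists; eauto.
      * rewrite (is_derive_unique (fun s : R => S s) _ _ Hd). field. lra.
    + intros t Ht. destruct Hap as [_ Ha].
      destruct (Ha t) as [_ [_ Hv]]; [lra|].
      rewrite Rabs_mult (Rabs_pos_eq (v t)) //.
      apply Rmult_le_compat_l; auto. apply Rabs_sin_turning_le; lra.
  - right. field. lra.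
Qed.

(** With the first chord fixed and the third vertex moving along the curve, the cross product starts
    at zero and changes at the rate bounded in [chord_cross_tangent_le]. Integrating that bound
    gives the product of the three arclengths. *)
Lemma triangle_area_le (t1 t2 t3 : R) :
  p <= t1 -> t1 <= t2 -> t2 <= t3 -> t3 <= q ->
  Rabs ((x t2 - x t1) * (y t3 - y t2) - (y t2 - y t1) * (x t3 - x t2))
  <= (S t2 - S t1) * (S t3 - S t2) * (S t3 - S t1) / (2 * r).
Proof.
  intros H1 H12 H23 H3.
  pose proof (derive_abs_le_increment
    (fun t => (x t2 - x t1) * (y t - y t2) - (y t2 - y t1) * (x t - x t2))
    (fun t => (S t2 - S t1) * (S t - S t2) * (S t - S t1) / (2 * r))
    (fun c => v c * ((x t2 - x t1) * sin (th c) - (y t2 - y t1) * cos (th c)))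
    (fun c => v c *
       ((S t2 - S t1) * ((S c - S t1) + (S c - S t2)) / (2 * r))) t2 t3) as H.
  cbv beta in H.
  replace (Rabs _) with (Rabs
    ((x t2 - x t1) * (y t3 - y t2) - (y t2 - y t1) * (x t3 - x t2)
     - ((x t2 - x t1) * (y t2 - y t2) - (y t2 - y t1) * (x t2 - x t2))))
    by (f_equal; ring).
  eapply Rle_trans.
  - apply H; auto.
    + intros t Ht. destruct Hap as [_ Ha].
      destruct (Ha t) as [Hx [Hy _]]; [lra|]. auto_derive.
      * repeat match goal with |- _ /\ _ => split end; try exact I; eexists; eauto.
      * rewrite (is_derive_unique (fun s : R => x s) _ _ Hx)
          (is_derive_unique (fun s : R => y s) _ _ Hy). ring.
    + intros t Ht. pose proof (HS t) as Hd. auto_derive.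
      * repeat match goal with |- _ /\ _ => split end; try exact I; eexists; eauto.
      * rewrite (is_derive_unique (fun s : R => S s) _ _ Hd). field. lra.
    + intros t Ht. destruct Hap as [_ Ha].
      destruct (Ha t) as [_ [_ Hv]]; [lra|].
      rewrite Rabs_mult (Rabs_pos_eq (v t)) //.
      apply Rmult_le_compat_l; auto. apply chord_cross_tangent_le; lra.
  - right. field. lra.
Qed.

End ArcLengthBounds.

(** * Triangles and collinear triples in the plane *)

(** Twice the signed area of the triangle [P Q T]. *)
Definition cross3 (P Q T : pt) : R :=
  (fst Q - fst P) * (snd T - snd Q) - (snd Q - snd P) * (fst T - fst Q).

Lemma cross3_swap12 (P Q T : pt) : cross3 Q P T = - cross3 P Q T.
Proof. unfold cross3. ring. Qed.

Lemma cross3_swap23 (P Q T : pt) : cross3 P T Q = - cross3 P Q T.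
Proof. unfold cross3. ring. Qed.

Lemma edist_pos (P Q : pt) : 0 <= edist P Q.
Proof. apply sqrt_pos. Qed.

Lemma edist_sqr (P Q : pt) :
  edist P Q ^ 2 = (fst P - fst Q) ^ 2 + (snd P - snd Q) ^ 2.
Proof.
  apply pow2_sqrt. apply Rplus_le_le_0_compat; apply pow2_ge_0.
Qed.

Lemma edist_sym (P Q : pt) : edist P Q = edist Q P.
Proof. unfold edist. f_equal. ring. Qed.

Lemma edist_triangle (P Q T : pt) : edist P T <= edist P Q + edist Q T.
Proof.
  unfold edist. rewrite -!Rsqr_pow2.
  apply (triangle (fst P) (snd P) (fst T) (snd T) (fst Q) (snd Q)).
Qed.

Lemma edist_eq0 (P Q : pt) : edist P Q = 0 -> P = Q.
Proof.
  intros E. pose proof (edist_sqr P Q) as H. rewrite E in H.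
  pose proof (pow2_ge_0 (fst P - fst Q)). pose proof (pow2_ge_0 (snd P - snd Q)).
  rewrite (surjective_pairing P) (surjective_pairing Q).
  f_equal; apply Rminus_diag_uniq, Rsqr_0_uniq; rewrite Rsqr_pow2; lra.
Qed.

Lemma cross_le_edist (P Q P' Q' : pt) :
  Rabs ((fst P - fst Q) * (snd P' - snd Q')
        - (snd P - snd Q) * (fst P' - fst Q'))
  <= edist P Q * edist P' Q'.
Proof.
  pose proof (edist_pos P Q). pose proof (edist_pos P' Q').
  pose proof (edist_sqr P Q) as E. pose proof (edist_sqr P' Q') as E'.
  rewrite -(Rabs_pos_eq (edist P Q * edist P' Q')); [|nra].
  apply Rsqr_le_abs_0. rewrite !Rsqr_pow2 Rpow_mult_distr E E'.
  set (a := fst P - fst Q). set (b := snd P - snd Q).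
  set (c := fst P' - fst Q'). set (d := snd P' - snd Q').
  (* Lagrange's identity: the squares of the cross and scalar products add up to the product of the
     squared lengths. *)
  pose proof (pow2_ge_0 (a * c + b * d)). nra.
Qed.

(** Expanding in the errors [Qi - Pi] gives three linear terms, each pairing an error with the
    opposite side, and three products of two errors. The latter make the inequality strict. *)
Lemma cross3_perturb (P1 P2 P3 Q1 Q2 Q3 : pt) (delta : R) :
  edist Q1 P1 < delta -> edist Q2 P2 < delta -> edist Q3 P3 < delta ->
  Rabs (cross3 Q1 Q2 Q3) <
  Rabs (cross3 P1 P2 P3)
  + delta * (edist P2 P1 + edist P3 P2 + edist P3 P1) + 3 * delta ^ 2.
Proof.
  intros H1 H2 H3.
  set (X := fun P Q P' Q' : pt =>
    (fst P - fst Q) * (snd P' - snd Q') - (snd P - snd Q) * (fst P' - fst Q')).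
  assert (E : cross3 Q1 Q2 Q3 = cross3 P1 P2 P3
    + (X Q3 P3 P2 P1 * -1 + X Q1 P1 P3 P2 * -1 + X Q2 P2 P3 P1)
    + (X Q1 P1 Q2 P2 + X Q2 P2 Q3 P3 + X Q3 P3 Q1 P1))
    by (unfold cross3, X; ring).
  pose proof (cross_le_edist Q3 P3 P2 P1) as L1.
  pose proof (cross_le_edist Q1 P1 P3 P2) as L2.
  pose proof (cross_le_edist Q2 P2 P3 P1) as L3.
  pose proof (cross_le_edist Q1 P1 Q2 P2) as L4.
  pose proof (cross_le_edist Q2 P2 Q3 P3) as L5.
  pose proof (cross_le_edist Q3 P3 Q1 P1) as L6.
  fold (X Q3 P3 P2 P1) in L1. fold (X Q1 P1 P3 P2) in L2.
  fold (X Q2 P2 P3 P1) in L3. fold (X Q1 P1 Q2 P2) in L4.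
  fold (X Q2 P2 Q3 P3) in L5. fold (X Q3 P3 Q1 P1) in L6.
  pose proof (edist_pos Q1 P1). pose proof (edist_pos Q2 P2).
  pose proof (edist_pos Q3 P3). pose proof (edist_pos P2 P1).
  pose proof (edist_pos P3 P2). pose proof (edist_pos P3 P1).
  apply Rabs_le_between in L1, L2, L3, L4, L5, L6.
  pose proof (Rle_abs (cross3 P1 P2 P3)).
  pose proof (Rle_abs (- cross3 P1 P2 P3)) as Hn. rewrite Rabs_Ropp in Hn.
  assert (edist Q3 P3 * edist P2 P1 <= delta * edist P2 P1) by nra.
  assert (edist Q1 P1 * edist P3 P2 <= delta * edist P3 P2) by nra.
  assert (edist Q2 P2 * edist P3 P1 <= delta * edist P3 P1) by nra.
  assert (edist Q1 P1 * edist Q2 P2 < delta ^ 2) by nra.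
  assert (edist Q2 P2 * edist Q3 P3 < delta ^ 2) by nra.
  assert (edist Q3 P3 * edist Q1 P1 < delta ^ 2) by nra.
  rewrite E. apply Rabs_def1; lra.
Qed.

(* Stewart's theorem for the cevian from [O] to [M]. *)
Lemma between_points_edist (O M A B : pt) (d c : R) :
  cross3 M A B = 0 -> 0 < d ->
  (fst A - fst M) * (fst B - fst M) + (snd A - snd M) * (snd B - snd M) <= 0 ->
  d <= edist A M -> d <= edist B M ->
  edist A O < c -> edist B O < c ->
  edist M O ^ 2 + d ^ 2 < c ^ 2.
Proof.
  intros Hcol Hd Hdot HA HB HAO HBO.
  pose proof (edist_pos A O). pose proof (edist_pos B O).
  assert (SA : edist A O ^ 2 < c ^ 2) by nra.
  assert (SB : edist B O ^ 2 < c ^ 2) by nra.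
  assert (DA : d ^ 2 <= edist A M ^ 2) by nra.
  assert (DB : d ^ 2 <= edist B M ^ 2) by nra.
  rewrite !edist_sqr in SA, SB, DA, DB |- *. unfold cross3 in Hcol.
  set (a1 := fst A - fst M) in *. set (a2 := snd A - snd M) in *.
  set (b1 := fst B - fst M) in *. set (b2 := snd B - snd M) in *.
  set (w1 := fst M - fst O) in *. set (w2 := snd M - snd O) in *.
  replace (fst A - fst O) with (a1 + w1) in SA by (unfold a1, w1; ring).
  replace (snd A - snd O) with (a2 + w2) in SA by (unfold a2, w2; ring).
  replace (fst B - fst O) with (b1 + w1) in SB by (unfold b1, w1; ring).
  replace (snd B - snd O) with (b2 + w2) in SB by (unfold b2, w2; ring).
  assert (Hcol' : a1 * b2 - a2 * b1 = 0).
  { rewrite -Hcol /a1 /a2 /b1 /b2. ring. }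
  set (n := a1 ^ 2 + a2 ^ 2) in *.
  assert (Hn : 0 < n) by nra.
  set (e := a1 * b1 + a2 * b2) in *.
  (* Chosen so that [B - M = - l * (A - M)]. *)
  set (l := - e / n).
  assert (Hl : 0 <= l).
  { apply Rmult_le_pos; [lra|]. apply Rlt_le, Rinv_0_lt_compat; auto. }
  assert (Eb1 : b1 = - l * a1).
  { apply Rmult_eq_reg_r with n; [|lra].
    transitivity (e * a1); [|unfold l; field; lra].
    transitivity (e * a1 - a2 * (a1 * b2 - a2 * b1)); [unfold e, n; ring|].
    rewrite Hcol'. ring. }
  assert (Eb2 : b2 = - l * a2).
  { apply Rmult_eq_reg_r with n; [|lra].
    transitivity (e * a2); [|unfold l; field; lra].
    transitivity (e * a2 + a1 * (a1 * b2 - a2 * b1)); [unfold e, n; ring|].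
    rewrite Hcol'. ring. }
  assert (Hln : d ^ 2 <= l * n).
  { assert (DB' : d ^ 2 <= l ^ 2 * n).
    { replace (l ^ 2 * n) with (b1 ^ 2 + b2 ^ 2)
        by (rewrite Eb1 Eb2; unfold n; ring). exact DB. }
    destruct (Rle_dec 1 l); nra. }
  rewrite Eb1 Eb2 in SB.
  (* Stewart's identity with weights [l] and 1. Here [l * n] is the product of the distances from
     [M] to [A] and [B]. *)
  assert (E : l * ((a1 + w1) ^ 2 + (a2 + w2) ^ 2)
     + ((- l * a1 + w1) ^ 2 + (- l * a2 + w2) ^ 2)
     = (l + 1) * (w1 ^ 2 + w2 ^ 2 + l * n)) by (unfold n; ring).
  nra.
Qed.

(** The pairwise products of the three scalar products sum to the square of [cross3 P Q T], so for
    collinear points the three cannot all be positive. *)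
Lemma collinear_has_middle (P Q T : pt) :
  cross3 P Q T = 0 ->
  let dot A B C := (fst B - fst A) * (fst C - fst A)
                   + (snd B - snd A) * (snd C - snd A) in
  dot P Q T <= 0 \/ dot Q P T <= 0 \/ dot T P Q <= 0.
Proof.
  intros H dot.
  assert (E : dot P Q T * dot Q P T + dot P Q T * dot T P Q
              + dot Q P T * dot T P Q = 0).
  { transitivity (cross3 P Q T ^ 2); [unfold dot, cross3; ring|].
    rewrite H. ring. }
  destruct (Rle_dec (dot P Q T) 0); auto.
  destruct (Rle_dec (dot Q P T) 0); auto.
  destruct (Rle_dec (dot T P Q) 0); auto. nra.
Qed.

(** * Lattice triangles and the smallness of [delta] *)

Lemma lattice_cross3 (v0 v1 v2 P Q T : pt) :
  in_lattice v0 v1 v2 P -> in_lattice v0 v1 v2 Q -> in_lattice v0 v1 v2 T ->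
  cross3 P Q T = 0 \/ lattice_area v1 v2 <= Rabs (cross3 P Q T).
Proof.
  intros [m1 [n1 ->]] [m2 [n2 ->]] [m3 [n3 ->]].
  set (j := ((m2 - m1) * (n3 - n2) - (n2 - n1) * (m3 - m2))%Z).
  match goal with |- ?c = 0 \/ _ => assert (E : c = IZR j * det2 v1 v2) end.
  { unfold cross3, det2, j; simpl.
    rewrite !minus_IZR !mult_IZR !minus_IZR. ring. }
  rewrite E. destruct (Z.eq_dec j 0) as [->|Hj]; [left; ring|right].
  unfold lattice_area. rewrite Rabs_mult -abs_IZR.
  assert (1 <= IZR (Z.abs j)) by (apply IZR_le; lia).
  pose proof (Rabs_pos (det2 v1 v2)). nra.
Qed.

Lemma lattice_min_dist_pos (v0 v1 v2 : pt) (d : R) :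
  is_lattice_min_dist v0 v1 v2 d -> 0 < d.
Proof.
  intros [[P [Q [_ [_ [Hne <-]]]]] _].
  destruct (edist_pos P Q) as [|E]; auto.
  destruct Hne. now apply edist_eq0.
Qed.

(** The square root is at least [R2], so [2 * delta * (2 * R2 + d) < d ^ 2]. Dropping either
    positive term on the left gives one of the two conclusions. *)
Lemma delta_bounds (R2 d delta : R) :
  0 < R2 -> 0 < d ->
  delta < d ^ 2 / (2 * (R2 + d + sqrt ((R2 + d) ^ 2 - d ^ 2))) ->
  0 < delta -> 2 * delta < d /\ 4 * R2 * delta < d ^ 2.
Proof.
  intros HR Hd Hdelta Hpos.
  assert (Hs : R2 <= sqrt ((R2 + d) ^ 2 - d ^ 2)).
  { rewrite -{1}(sqrt_pow2 R2); [|lra]. apply sqrt_le_1_alt. nra. }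
  set (w := sqrt ((R2 + d) ^ 2 - d ^ 2)) in *.
  assert (Hm : delta * (2 * (R2 + d + w)) < d ^ 2).
  { apply (Rmult_lt_compat_r (2 * (R2 + d + w))) in Hdelta; [|lra].
    replace (d ^ 2 / (2 * (R2 + d + w)) * (2 * (R2 + d + w))) with (d ^ 2)
      in Hdelta by (field; lra). exact Hdelta. }
  assert (2 * delta * (2 * R2 + d) < d ^ 2) by nra.
  split; nra.
Qed.

(** * Three points close to the arc *)

Section NearLatticePoints.

Variables (a b : R) (x y v th k S : R -> R) (R1 R2 delta : R).
Hypothesis Hap : angle_param a b x y v th k.
Hypothesis HS : forall t, is_derive S t (v t).
Hypothesis HR1 : 0 < R1.
Hypothesis Hk1 : forall t, a <= t <= b -> 0 <= R1 * k t <= v t.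
Hypothesis HR2 : 0 < R2.
Hypothesis Hk2 : forall t, a <= t <= b -> v t <= R2 * k t.
Hypothesis Htot : th b - th a <= PI.
Hypothesis Hdelta : 0 < delta.

Let near (Q : pt) (t : R) := a <= t <= b /\ edist Q (x t, y t) < delta.

Lemma near_cross3_lt_sorted (Q1 Q2 Q3 : pt) (t1 t2 t3 : R) :
  near Q1 t1 -> near Q2 t2 -> near Q3 t3 -> t1 <= t2 -> t2 <= t3 ->
  Rabs (cross3 Q1 Q2 Q3) <
  (S b - S a) ^ 3 / (8 * R1) + 2 * (S b - S a) * delta + 3 * delta ^ 2.
Proof.
  intros [Ht1 H1] [Ht2 H2] [Ht3 H3] H12 H23.
  pose proof (cross3_perturb _ _ _ _ _ _ _ H1 H2 H3) as HQ.
  pose proof (triangle_area_le a b x y v th k S Hap HS R1 HR1 Hk1 t1 t2 t3)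
    as HP.
  pose proof (chord_le_arclength a b x y v th k S Hap HS) as Hc.
  pose proof (Hc t1 t2). pose proof (Hc t2 t3). pose proof (Hc t1 t3).
  pose proof (arclength_nondecreasing a b x y v th k S Hap HS) as Hm.
  pose proof (Hm a t1). pose proof (Hm t1 t2). pose proof (Hm t2 t3).
  pose proof (Hm t3 b).
  set (L := S b - S a) in *.
  set (s := S t2 - S t1) in *. set (u := S t3 - S t2) in *.
  replace (S t3 - S t1) with (s + u) in * by (unfold s, u; ring).
  assert (Hs : 0 <= s) by (unfold s; lra).
  assert (Hu : 0 <= u) by (unfold u; lra).
  assert (HL : s + u <= L) by (unfold s, u, L; lra).
  (* The constant 8 comes from [4 * s * u <= (s + u) ^ 2]. *)
  assert (Hcube : s * u * (s + u) / (2 * R1) <= L ^ 3 / (8 * R1)).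
  { apply (Rmult_le_reg_r (8 * R1)); [lra|].
    replace (s * u * (s + u) / (2 * R1) * (8 * R1))
      with (4 * s * u * (s + u)) by (field; lra).
    replace (L ^ 3 / (8 * R1) * (8 * R1)) with (L ^ 3) by (field; lra).
    assert (4 * s * u <= (s + u) ^ 2) by (pose proof (pow2_ge_0 (s - u)); nra).
    assert ((s + u) ^ 3 <= L ^ 3) by (apply pow_incr; lra).
    nra. }
  unfold cross3 at 2 in HQ. simpl fst in HQ. simpl snd in HQ.
  (* The two consecutive chords together are at most [L], and so is the third. *)
  assert (edist (x t2, y t2) (x t1, y t1) + edist (x t3, y t3) (x t2, y t2)
          + edist (x t3, y t3) (x t1, y t1) <= 2 * L) by lra.
  assert (delta * (edist (x t2, y t2) (x t1, y t1)
          + edist (x t3, y t3) (x t2, y t2)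
          + edist (x t3, y t3) (x t1, y t1)) <= delta * (2 * L)) by nra.
  lra.
Qed.

(** Permuting the points changes only the sign of [cross3], so the parameters may be sorted. Of the
    eight outcomes of the comparisons, [lra] discards the two cyclic ones. *)
Lemma near_cross3_lt (Q1 Q2 Q3 : pt) (t1 t2 t3 : R) :
  near Q1 t1 -> near Q2 t2 -> near Q3 t3 ->
  Rabs (cross3 Q1 Q2 Q3) <
  (S b - S a) ^ 3 / (8 * R1) + 2 * (S b - S a) * delta + 3 * delta ^ 2.
Proof.
  intros H1 H2 H3.
  destruct (Rle_dec t1 t2), (Rle_dec t2 t3), (Rle_dec t1 t3); try lra.
  - now apply (near_cross3_lt_sorted Q1 Q2 Q3 t1 t2 t3).
  - rewrite -Rabs_Ropp -cross3_swap23.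
    apply (near_cross3_lt_sorted Q1 Q3 Q2 t1 t3 t2); auto; lra.
  - rewrite -Rabs_Ropp -cross3_swap23 -Rabs_Ropp -cross3_swap12.
    apply (near_cross3_lt_sorted Q3 Q1 Q2 t3 t1 t2); auto; lra.
  - rewrite -Rabs_Ropp -cross3_swap12.
    apply (near_cross3_lt_sorted Q2 Q1 Q3 t2 t1 t3); auto; lra.
  - rewrite -Rabs_Ropp -cross3_swap12 -Rabs_Ropp -cross3_swap23.
    apply (near_cross3_lt_sorted Q2 Q3 Q1 t2 t3 t1); auto; lra.
  - rewrite -Rabs_Ropp -cross3_swap12 -Rabs_Ropp -cross3_swap23
      -Rabs_Ropp -cross3_swap12.
    apply (near_cross3_lt_sorted Q3 Q2 Q1 t3 t2 t1); auto; lra.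
Qed.

(* All three points are compared with the disc of radius [R2] that touches the
   curve at the point close to [M]. *)
Lemma near_middle_absurd (M A B : pt) (tM tA tB d : R) :
  near M tM -> near A tA -> near B tB ->
  2 * delta < d -> 4 * R2 * delta < d ^ 2 ->
  d <= edist A M -> d <= edist B M -> cross3 M A B = 0 ->
  ~ (fst A - fst M) * (fst B - fst M)
    + (snd A - snd M) * (snd B - snd M) <= 0.
Proof.
  intros [HtM HM] [HtA HA] [HtB HB] Hd1 Hd2 HdA HdB Hcol Hdot.
  set (O := (x tM - R2 * sin (th tM), y tM + R2 * cos (th tM))).
  pose proof (in_tangent_disc a b R2 x y v th k tM tA Hap HR2 Hk2 Htot HtM HtA)
    as DA.
  pose proof (in_tangent_disc a b R2 x y v th k tM tB Hap HR2 Hk2 Htot HtM HtB)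
    as DB.
  fold O in DA, DB.
  pose proof (edist_triangle A (x tA, y tA) O).
  pose proof (edist_triangle B (x tB, y tB) O).
  pose proof (edist_triangle (x tM, y tM) M O) as HMO.
  rewrite (edist_sym (x tM, y tM) M) in HMO.
  assert (EO : edist (x tM, y tM) O = R2).
  { unfold edist, O; simpl fst; simpl snd.
    pose proof (sin2_cos2 (th tM)) as E. rewrite !Rsqr_pow2 in E.
    transitivity (sqrt (R2 ^ 2)); [f_equal|apply sqrt_pow2; lra].
    transitivity (R2 ^ 2 * (sin (th tM) ^ 2 + cos (th tM) ^ 2)); [ring|].
    rewrite E. ring. }
  pose proof (between_points_edist O M A B d (R2 + delta) Hcol) as HF.
  assert (Hlt : edist M O ^ 2 + d ^ 2 < (R2 + delta) ^ 2)
    by (apply HF; auto; lra).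
  pose proof (edist_pos M O).
  (* If [delta <= R2], squaring [R2 - delta < edist M O] gives [d ^ 2 < 4 * R2 * delta]. Otherwise
     [R2 + delta < 2 * delta < d] already contradicts [Hlt]. *)
  destruct (Rle_dec delta R2); nra.
Qed.

End NearLatticePoints.

Theorem theorem7p6
  (a b : R) (x y x1 y1 x2 y2 : R -> R) (R1 R2 : R)
  (v0 v1 v2 : pt) (dL delta : R) :
  convex_arc a b x y x1 y1 x2 y2 ->
  RInt (fun t => curvature x1 y1 x2 y2 t * speed x1 y1 t) a b <= PI ->
  0 < R1 -> R1 <= R2 ->
  (forall t, a <= t <= b ->
     R1 <= / curvature x1 y1 x2 y2 t <= R2) ->
  lin_indep v1 v2 ->
  is_lattice_min_dist v0 v1 v2 dL ->
  0 < delta ->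
  delta < dL ^ 2 /
          (2 * (R2 + dL + sqrt ((R2 + dL) ^ 2 - dL ^ 2))) ->
  (let L := RInt (fun t => speed x1 y1 t) a b in
   L ^ 3 / (8 * R1) + 2 * L * delta + 3 * delta ^ 2 <= lattice_area v1 v2) ->
  forall l : list pt,
    NoDup l ->
    (forall Q, In Q l -> in_lattice v0 v1 v2 Q /\ dist_to_curve_lt a b x y Q delta) ->
    (length l <= 2)%nat.
Proof.
  intros [Hreg [Hcurv _]] Htot HR1 HR12 HR _ Hmin Hdelta Hbound HL l Hnd Hl.
  destruct (regular_curve_angle_param _ _ _ _ _ _ _ _ Hreg)
    as (v & S & th & k & Hap & HS & Hvk & ES & Eth).
  cbv zeta in HL. rewrite -ES in HL. rewrite -Eth in Htot.
  pose proof (lattice_min_dist_pos _ _ _ _ Hmin) as Hd.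
  destruct (delta_bounds R2 dL delta) as [Hd1 Hd2]; auto; [lra|].
  (* Since [k] is the curvature times [v], the bounds on the radius of curvature become linear
     inequalities between [k] and [v]. *)
  assert (Hk : forall t, a <= t <= b ->
            0 <= R1 * k t <= v t /\ v t <= R2 * k t).
  { intros t Ht. destruct (Hvk t Ht) as [Hv ->].
    pose proof (HR t Ht) as Hrho. pose proof (Hcurv t Ht) as Hc.
    set (c := curvature x1 y1 x2 y2 t) in *.
    assert (Ec : / c * c = 1) by (field; lra).
    assert (R1 * c <= 1) by nra. assert (1 <= R2 * c) by nra.
    assert (0 < R1 * c) by nra.
    split; [split|]; nra. }
  destruct l as [|A [|B [|C l]]]; simpl; try lia. exfalso.
  destruct (Hl A) as [LA [tA HA]]; [simpl; auto|].
  destruct (Hl B) as [LB [tB HB]]; [simpl; auto|].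
  destruct (Hl C) as [LC [tC HC]]; [simpl; auto|].
  inversion Hnd as [|? ? NA Hnd1]; subst.
  inversion Hnd1 as [|? ? NB Hnd2]; subst.
  simpl in NA, NB.
  assert (Hsep : forall P Q, in_lattice v0 v1 v2 P -> in_lattice v0 v1 v2 Q ->
            P <> Q -> dL <= edist P Q) by apply Hmin.
  assert (A <> B) by intuition congruence.
  assert (A <> C) by intuition congruence.
  assert (B <> C) by intuition congruence.
  destruct (lattice_cross3 v0 v1 v2 A B C LA LB LC) as [Hcol|Harea].
  - assert (Habs := near_middle_absurd a b x y v th k R2 delta Hap ltac:(lra)
      (fun t Ht => proj2 (Hk t Ht)) Htot Hdelta).
    (* Each of the three points may be the middle one; it takes the role of [M]. *)
    destruct (collinear_has_middle A B C Hcol) as [Hm|[Hm|Hm]]; revert Hm.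
    + apply (Habs A B C tA tB tC dL); auto.
    + apply (Habs B A C tB tA tC dL); auto.
      rewrite cross3_swap12 Hcol. ring.
    + apply (Habs C A B tC tA tB dL); auto.
      rewrite cross3_swap12 cross3_swap23 Hcol. ring.
  - assert (Hlt := near_cross3_lt a b x y v th k S R1 delta Hap HS HR1
      (fun t Ht => proj1 (Hk t Ht)) Hdelta A B C tA tB tC HA HB HC).
    lra.
Qed.
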